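(* Let $(\mathcal{S},d)$ be a nonempty finite metric space, let $1\le n\le k$ be integers, let $p:\mathcal{S}^n\to[0,1]$ be a probability mass function, and let $$\mathcal{U}=\{u\in\{1,\ldots,k\}^n : u_i\ne u_j\text{ for } i\ne j\}.$$ Consider the stochastic $k$-server problem with $n$ requests per period on $(\mathcal{S},d)$ with request distribution $p$, with state space $\mathcal{X}=\mathcal{S}^{k}\times\mathcal{S}^n$. Let $m^*=(m_1^*,\ldots,m_k^* )\in\mathcal{S}^k$ minimize $$\sum_{s\in\mathcal{S}^n}p(s)\min_{u\in\mathcal{U}}\Big\{\sum_{j=1}^n d(m_{u_j},s_j)\Big\}$$ over $m\in\mathcal{S}^k$. Let $\mu_d$ be the decentralized policy which, in state $x=(x_1,\ldots,x_k,\widehat{x}_1,\ldots,\widehat{x}_n)$, chooses $$\mu_d(x)\in\operatorname*{argmin}_{u\in\mathcal{U}}\Big\{\sum_{j=1}^n d(m^*_{u_j},\widehat{x}_j)\Big\},$$ where the choice of minimizer depends only on $(\widehat{x}_1,\ldots,\widehat{x}_n)$. Let $\mu_*$ be an optimal static state-feedback policy. Then $$J(\mu_d,x(0))\le 2\,J(\mu_*,x(0))\qquad\text{for all }x(0)\in\mathcal{X}.$$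
   Context: Stochastic $k$-server problem with $n$ requests per period: at each time $t\in\{0,1,2,\ldots\}$ the state is $x(t)=(x_1(t),\ldots,x_k(t),\widehat{x}_1(t),\ldots,\widehat{x}_n(t))\in\mathcal{X}=\mathcal{S}^k\times\mathcal{S}^n$, where $x_i(t)$ is the location of server $i$ and $\widehat{x}_j(t)$ is the location of the $j$-th current request. An action $u(t)=(u_1(t),\ldots,u_n(t))\in\mathcal{U}$ is chosen, where $u_j(t)$ is the index of the server assigned to request $j$, and the cost $r(x(t),u(t))=\sum_{j=1}^n d(x_{u_j(t)}(t),\widehat{x}_j(t))$ is incurred. Then $x_{u_j(t)}(t+1)=\widehat{x}_j(t)$ for $j=1,\ldots,n$, $x_i(t+1)=x_i(t)$ for every $i\notin\{u_1(t),\ldots,u_n(t)\}$, and the next vector of requests $(\widehat{x}_1(t+1),\ldots,\widehat{x}_n(t+1))$ is drawn from $p$, independently of everything up to time $t$. A static state-feedback policy is a function $\mu:\mathcal{X}\to\mathcal{U}$; under it $u(t)=\mu(x(t))$, so the state evolves as a finite Markov chain $X(t)$. Its average per-period cost from initial state $x(0)$ is $$J(\mu,x(0))=\lim_{t\to\infty}\frac{1}{t+1}\sum_{\tau=0}^{t}E\big[r(X(\tau),\mu(X(\tau)))\,\big|\,X(0)=x(0)\big].$$ An optimal policy $\mu_*$ is a static state-feedback policy which minimizes $J(\mu,x(0))$ over all static state-feedback policies $\mu$, for every $x(0)\in\mathcal{X}$. *)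

(* Defs.v *)
From HB Require Import structures.
From mathcomp Require Import all_boot all_order all_algebra.
From mathcomp Require Import all_classical all_reals all_analysis.

Set Implicit Arguments.
Unset Strict Implicit.
Unset Printing Implicit Defensive.

Import Order.TTheory GRing.Theory Num.Theory numFieldNormedType.Exports.

Local Open Scope classical_set_scope.
Local Open Scope ring_scope.

#[short(type="finMetricType")]
HB.structure Definition FinMetric (K : numDomainType) :=
  { M of Finite M & Metric K M }.

(** Servers are indexed by ['I_k] and requests by ['I_n]; [u j] is the server
    assigned to request [j], and distinct requests get distinct servers. *)
Definition action (k n : nat) := {u : {ffun 'I_n -> 'I_k} | injectiveb u}.

Fact default_action_subproof k n (hnk : (n <= k)%N) :
  injectiveb [ffun j : 'I_n => widen_ord hnk j].
Proof.
by apply/injectiveP => i j; rewrite !ffunE => -[/val_inj].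
Qed.

(** A witness that [action k n] is nonempty, which [arg min] below requires. *)
Definition default_action k n (hnk : (n <= k)%N) : action k n :=
  Sub [ffun j => widen_ord hnk j] (default_action_subproof hnk).

Section KServer.
Context {R : realType} {S : finMetricType R} {k n : nat}.

Definition servers := {ffun 'I_k -> S}.
Definition requests := {ffun 'I_n -> S}.

Definition state := (servers * requests)%type.
Definition policy := state -> action k n.

Definition is_pmf (p : requests -> R) : Prop :=
  (forall s, 0 <= p s <= 1) /\ \sum_s p s = 1.

Definition assignment_cost (m : servers) (s : requests) (u : action k n) : R :=
  \sum_(j < n) mdist (m (val u j)) (s j).

Definition cost (x : state) (u : action k n) : R := assignment_cost x.1 x.2 u.

(** [s] is the next vector of requests; since an action is injective, at most
    one [j] can be picked for each server [i]. *)
Definition next_state (mu : policy) (x : state) (s : requests) : state :=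
  ([ffun i => if [pick j | val (mu x) j == i] is Some j
              then x.2 j else x.1 i], s).

(** E[cost (X t) (mu (X t)) | X 0 = x0]: the successive request vectors
    [w_0, ..., w_(t-1)] are i.i.d. with law [p], and [X t] is the state reached
    from [x0] when they are revealed in this order. *)
Definition expected_cost (p : requests -> R) (mu : policy) (x0 : state)
    (t : nat) : R :=
  \sum_(w : t.-tuple requests)
    (\prod_(s <- w) p s) *
    (let x := foldl (next_state mu) x0 w in cost x (mu x)).

(** For a probability mass function [p] the averages always converge, the state
    being a Markov chain on a finite set, so that [lim] is a genuine limit. *)
Definition average_cost (p : requests -> R) (mu : policy) (x0 : state) : R :=
  lim ((fun t : nat =>
    (t.+1%:R)^-1 * \sum_(0 <= tau < t.+1) expected_cost p mu x0 tau) @ \oo).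

Definition optimal_policy (p : requests -> R) (mu : policy) : Prop :=
  forall (mu' : policy) (x0 : state),
    average_cost p mu x0 <= average_cost p mu' x0.

Definition min_assignment_cost (hnk : (n <= k)%N) (m : servers)
    (s : requests) : R :=
  assignment_cost m s
    [arg min_(u < default_action hnk) assignment_cost m s u]%O.

Definition placement_cost (hnk : (n <= k)%N) (p : requests -> R)
    (m : servers) : R :=
  \sum_s p s * min_assignment_cost hnk m s.

Definition optimal_placement (hnk : (n <= k)%N) (p : requests -> R)
    (m : servers) : Prop :=
  forall m' : servers, placement_cost hnk p m <= placement_cost hnk p m'.

(** The second condition says that ties between minimizers are broken by a rule
    that only looks at the requests. *)
Definition decentralized_policy (m : servers) (mu : policy) : Prop :=
  (forall (x : state) (u : action k n),
     assignment_cost m x.2 (mu x) <= assignment_cost m x.2 u) /\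
  (forall x y : state, x.2 = y.2 -> mu x = mu y).

End KServer.

Arguments servers {R} S k.
Arguments requests {R} S n.
Arguments state {R} S k n.
Arguments policy {R} S k n.

(* Main.v *)
(** Averaging over the next requests, which are independent of the server
    locations, shows that every policy pays at least the optimal placement cost
    C at each time t >= 1.  Conversely, in state x the decentralized policy pays
    at most B + (B + D - D'), where B is the assignment cost from m* to the
    requests, of mean C, and D, D' are the total displacements of the servers
    from m* before and after the move; D telescopes, so the average is at most
    2 C.  The averages converge by the mean ergodic theorem: for a power-bounded
    operator P in finite dimension, a fixed vector v = w - P w vanishes, since
    N v = w - P^N w is bounded, and hence ker (1 - P) + im (1 - P) is everything.
 *)
Require Import Defs.
From HB Require Import structures.
From mathcomp Require Import all_boot all_order all_algebra.
From mathcomp Require Import all_classical all_reals all_analysis.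
From mathcomp Require Import ring lra.
Import Order.TTheory GRing.Theory Num.Theory numFieldNormedType.Exports.
Local Open Scope ring_scope.

(** * Mean ergodic theorem in finite dimension *)

Lemma cvg_bounded_div (R : realType) (u : nat -> R) (M : R) :
  (forall N, `|u N| <= M) ->
  ((fun N : nat => N.+1%:R^-1 * u N) @ \oo --> (0 : R))%classic.
Proof.
move=> uM.
have cvgM (c : R) : ((fun N => harmonic N * c) @ \oo --> (0 : R))%classic.
  rewrite -[X in (_ --> X)%classic](mul0r c); apply: cvgMl.
  exact: cvg_harmonic.
apply: squeeze_cvgr (cvgM (- M)) (cvgM M).
near=> N; have := uM N; rewrite ler_norml => /andP[h1 h2].
by rewrite /harmonic !ler_pM2l ?invr_gt0 ?ltr0n // h1 h2.
Unshelve. all: by end_near. Qed.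

(** The hypothesis says that kernel and image of [1 - P] meet only in 0; by rank-nullity their
    dimensions add up to that of [V]. *)
Lemma fixpoint_coboundary_decomposition (K : fieldType) (V : vectType K)
    (P : {linear V -> V}) :
  (forall v w, P v = v -> v = w - P w -> v = 0) ->
  forall f, exists v w, P v = v /\ f = v + (w - P w).
Proof.
move=> trivI f; pose D : 'End(V) := (\1 - linfun P)%VF.
have DE v : D v = v - P v by rewrite /D !lfun_simp.
have capD : (lker D :&: limg D = 0)%VS.
  apply/eqP; rewrite -subv0; apply/subvP => v /memv_capP[].
  rewrite memv_ker DE subr_eq0 => /eqP/esym Pv /memv_imgP[w _].
  by rewrite DE => vE; rewrite memv0; apply/eqP; exact: trivI vE.
have sumD : (lker D + limg D = fullv)%VS.
  apply/eqP; rewrite eqEdim subvf /= dimv_disjoint_sum //.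
  by rewrite -(limg_ker_dim D fullv) capfv.
have : f \in (lker D + limg D)%VS by rewrite sumD memvf.
case/memv_addP => v; rewrite memv_ker DE subr_eq0 => /eqP/esym Pv.
by case=> _ /memv_imgP[w _ ->] ->; exists v, w; rewrite DE.
Qed.

Section MeanErgodic.
Context {R : realType} {T : finType}.
Variable P : {linear {ffun T -> R^o} -> {ffun T -> R^o}}.

Lemma sum_iter_coboundary (w : {ffun T -> R^o}) N :
  \sum_(0 <= t < N) iter t P (w - P w) = w - iter N P w.
Proof.
elim: N => [|N IH]; first by rewrite big_geq //= subrr.
have iterB t (f g : {ffun T -> R^o}) :
    iter t P (f - g) = iter t P f - iter t P g.
  by elim: t => //= t ->; rewrite linearB.
by rewrite big_nat_recr //= IH iterB -iterSr /= addrA subrK.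
Qed.

Lemma iter_fix (v : {ffun T -> R^o}) t : P v = v -> iter t P v = v.
Proof. by move=> Pv; elim: t => //= t ->. Qed.

Hypothesis powerP : forall f : {ffun T -> R^o},
  exists M : R, forall t x, `|iter t P f x| <= M.

Lemma cvg_cesaro_coboundary (w : {ffun T -> R^o}) x :
  ((fun N : nat => N.+1%:R^-1 *
      \sum_(0 <= t < N.+1) iter t P (w - P w) x) @ \oo --> (0 : R))%classic.
Proof.
have [M wM] := powerP w.
apply: (@cvg_bounded_div _ _ (M + M)) => N.
have := congr1 (fun f : {ffun T -> R^o} => f x) (sum_iter_coboundary w N.+1).
rewrite sum_ffunE !ffunE => ->.
by rewrite (le_trans (ler_normB _ _)) // lerD // ?wM // (wM 0%N).
Qed.

Lemma is_cvg_cesaro (f : {ffun T -> R^o}) x :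
  cvgn (fun N : nat => N.+1%:R^-1 * \sum_(0 <= t < N.+1) iter t P f x).
Proof.
have trivI (v w : {ffun T -> R^o}) : P v = v -> v = w - P w -> v = 0.
  move=> Pv vE; apply/ffunP => y; rewrite ffunE.
  (* The Cesaro averages of a fixed coboundary are constantly [v y], yet tend to 0. *)
  have := @cvg_cesaro_coboundary w y; rewrite -vE.
  under eq_fun do under eq_bigr do rewrite iter_fix //.
  under eq_fun do rewrite sumr_const_nat subn0
    -[v y *+ _]mulr_natl mulKf ?pnatr_eq0 //.
  by move=> h; apply: (cvg_unique _ (cvg_cst _) h).
have [v [w [Pv fE]]] := fixpoint_coboundary_decomposition _ _ _ trivI f.
have iterD t : iter t P f = v + iter t P (w - P w).
  by elim: t => //= t ->; rewrite linearD Pv.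
under eq_fun => N.
  under eq_bigr do rewrite iterD ffunE.
  rewrite big_split /= sumr_const_nat subn0 -[v x *+ _]mulr_natl mulrDr.
  rewrite mulKf ?pnatr_eq0 //; over.
apply: is_cvgD; first exact: is_cvg_cst.
by apply/cvg_ex; exists 0; exact: cvg_cesaro_coboundary.
Qed.

End MeanErgodic.

(** * Markov operators driven by independent inputs *)

Section Transition.
Context {R : realType} {T A : finType}.
Variables (p : A -> R) (g : T -> A -> T).

Definition transition (f : {ffun T -> R^o}) : {ffun T -> R^o} :=
  [ffun x => \sum_a p a * f (g x a)].

Lemma transition_is_linear : linear transition.
Proof.
move=> c f h; apply/ffunP => x; rewrite !ffunE scaler_sumr -big_split /=.
by apply: eq_bigr => a _; rewrite !ffunE mulrDr; congr (_ + _);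
   rewrite /GRing.scale /=; ring.
Qed.

HB.instance Definition _ := GRing.isLinear.Build R _ _ _ transition
  transition_is_linear.

(** Conditioning on the first letter of [w], which [foldl] reads first, leaves a word of length [t]
    started from [g x a]. *)
Lemma iter_transition (f : {ffun T -> R^o}) t x :
  \sum_(w : t.-tuple A) (\prod_(a <- w) p a) * f (foldl g x w) =
  iter t transition f x.
Proof.
elim: t x => [|t IH] x /=.
  by rewrite (big_pred1 [tuple]) ?big_nil ?mul1r // => w; apply/esym/eqP; exact: tuple0.
rewrite ffunE.
under [RHS]eq_bigr do rewrite -IH big_distrr /=.
rewrite pair_big /=.
rewrite (reindex (fun aw : A * t.-tuple A => [tuple of aw.1 :: aw.2])) /=;
  last first.
  exists (fun w : t.+1.-tuple A => (thead w, [tuple of behead w])).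
    by case=> a w _ /=; rewrite theadE; congr pair; apply: val_inj.
  by move=> w _; rewrite /= -tuple_eta.
by apply: eq_bigr => -[a w] _ /=; rewrite big_cons mulrA.
Qed.

Hypothesis p_ge0 : forall a, 0 <= p a.

Lemma iter_transition_le t (f h : {ffun T -> R^o}) :
  (forall x, f x <= h x) ->
  forall x, iter t transition f x <= iter t transition h x.
Proof.
move=> fh; elim: t => //= t IH x; rewrite !ffunE.
by apply: ler_sum => a _; rewrite ler_wpM2l.
Qed.

Hypothesis p_sum1 : \sum_a p a = 1.

Lemma transition_cst (f : {ffun T -> R^o}) x c :
  (forall a, f (g x a) = c) -> transition f x = c.
Proof.
by move=> fc; rewrite ffunE; under eq_bigr do rewrite fc;
   rewrite -mulr_suml p_sum1 mul1r.
Qed.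

Lemma iter_transition_cst t (c : R) x :
  iter t transition ([ffun=> c] : {ffun T -> R^o}) x = c.
Proof.
rewrite iter_fix ?ffunE //; apply/ffunP => y; rewrite [RHS]ffunE.
by apply: transition_cst => a; rewrite ffunE.
Qed.

(** The operator is monotone and fixes constants, so bounds [-M <= f <= M] survive every iterate. *)
Lemma power_bounded_transition (f : {ffun T -> R^o}) :
  exists M : R, forall t x, `|iter t transition f x| <= M.
Proof.
pose M : R := \sum_x `|f x|.
have fM x : `|f x| <= M by rewrite /M (bigD1 x) //= lerDl sumr_ge0.
exists M => t x; rewrite ler_norml -{1}(iter_transition_cst t (- M) x).
rewrite -{2}(iter_transition_cst t M x).
by rewrite !iter_transition_le // => y; rewrite ffunE;
   have := fM y; rewrite ler_norml => /andP[].
Qed.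

End Transition.

(** * Cost bounds for the server problem *)

Section KServer.
Context {R : realType} {S : finMetricType R} {k n : nat}.
Variables (hnk : (n <= k)%N) (p : requests S n -> R).
Hypothesis hp : is_pmf p.

Let p_ge0 s : 0 <= p s. Proof. by have [/(_ s)/andP[]] := hp. Qed.
Let p_sum1 : \sum_s p s = 1. Proof. by case: hp. Qed.

Lemma min_assignment_cost_le (m : servers S k) s (u : action k n) :
  min_assignment_cost hnk m s <= assignment_cost m s u.
Proof. by rewrite /min_assignment_cost; case: arg_minP => // i _; apply. Qed.

Definition policy_cost (mu : policy S k n) : {ffun state S k n -> R^o} :=
  [ffun x : state S k n => cost x (mu x)].

Lemma expected_costE (mu : policy S k n) x t :
  expected_cost p mu x t =
  iter t (transition p (next_state mu)) (policy_cost mu) x.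
Proof.
by rewrite -iter_transition; apply: eq_bigr => w _; rewrite ffunE.
Qed.

Lemma is_cvg_average_cost (mu : policy S k n) x :
  cvgn (fun t : nat =>
    t.+1%:R^-1 * \sum_(0 <= tau < t.+1) expected_cost p mu x tau).
Proof.
under eq_fun do under eq_bigr do rewrite expected_costE.
apply: is_cvg_cesaro; exact: power_bounded_transition.
Qed.

(* The server locations reached after one step do not depend on the next
   requests, so averaging over these gives a placement cost. *)
Lemma expected_cost_ge (C : R) (mu : policy S k n) x t :
  (forall m, C <= placement_cost hnk p m) -> C <= expected_cost p mu x t.+1.
Proof.
move=> hC; rewrite expected_costE iterSr.
rewrite -{1}(iter_transition_cst p (next_state mu) p_sum1 t C x).
apply: iter_transition_le => // y; rewrite !ffunE.
pose s0 := y.2; apply: le_trans (hC (next_state mu y s0).1) _.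
apply: ler_sum => s _; rewrite ler_wpM2l // ffunE.
exact: min_assignment_cost_le.
Qed.

Definition displacement (m : servers S k) : {ffun state S k n -> R^o} :=
  [ffun x : state S k n => \sum_i mdist (x.1 i) (m i)].

Lemma displacement_ge0 m x : 0 <= displacement m x.
Proof. by rewrite ffunE sumr_ge0 // => i _; exact: mdist_ge0. Qed.

(** Idle servers contribute equally before and after; server [u j] trades its old distance to
    [m (u j)] for that of request [j]. *)
Lemma displacement_next m (mu : policy S k n) x s :
  displacement m (next_state mu x s) =
  displacement m x
    - \sum_j mdist (x.1 (val (mu x) j)) (m (val (mu x) j))
    + assignment_cost m x.2 (mu x).
Proof.
set u := val (mu x).
have u_inj : injective u by apply/injectiveP; exact: (valP (mu x)).
have splitE (F : 'I_k -> R) :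
    \sum_i F i = \sum_j F (u j) + \sum_(i | i \notin codom u) F i.
  rewrite (bigID (mem (codom u))) /=; congr (_ + _).
  rewrite -big_uniq; last by exact/injectiveP.
  by rewrite big_image.
have at_u j : [pick j' | u j' == u j] = Some j.
  by case: pickP => [j' /eqP/u_inj -> //|/(_ j)]; rewrite eqxx.
have off_u i : i \notin codom u -> [pick j | u j == i] = None.
  by case: pickP => // j /eqP <-; rewrite codom_f.
rewrite !ffunE /= !splitE.
rewrite -[sval (mu x)]/u.
under [X in X + _ = _]eq_bigr do rewrite ffunE at_u.
under [X in _ + X = _]eq_bigr => i iu do rewrite ffunE off_u //.
under [X in X + _ = _]eq_bigr do rewrite metric_sym.
rewrite /assignment_cost -/u; ring.
Qed.

(** The triangle inequality through [m (u j)] bounds the cost by [B + A], while the displacement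
    drops by exactly [B - A], whatever the next requests. *)
Lemma cost_le_displacement m (mu : policy S k n) x :
  cost x (mu x) <= 2 * assignment_cost m x.2 (mu x) + displacement m x -
    transition p (next_state mu) (displacement m) x.
Proof.
rewrite (transition_cst _ _ p_sum1 _ _ _ (displacement_next m mu x)).
set A := assignment_cost m _ _; set D := displacement m x.
set B := \sum_j _; suff : cost x (mu x) <= B + A by lra.
rewrite -big_split /=; apply: ler_sum => j _; exact: metric_triangle.
Qed.

Lemma sum_expected_cost_le (m : servers S k) (mu : policy S k n) x :
  decentralized_policy m mu ->
  exists K, forall t, \sum_(0 <= tau < t.+1) expected_cost p mu x tau <=
    2 * placement_cost hnk p m * t.+1%:R + K.
Proof.
move=> [mu_min _]; set C := placement_cost hnk p m.
pose P := transition p (next_state mu).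
pose B : {ffun state S k n -> R^o} :=
    [ffun x : state S k n => assignment_cost m x.2 (mu x)].
(* After one step the requests have law [p] from any state, and [mu] serves them at minimal
   assignment cost from [m]. *)
have PB : P B = [ffun=> C].
  apply/ffunP => y; rewrite !ffunE; apply: eq_bigr => s _; congr (_ * _).
  rewrite ffunE; apply/eqP; rewrite eq_le min_assignment_cost_le andbT.
  exact: (mu_min (next_state mu y s)).
pose D := displacement m.
(* At time 0 the requests are given, so [B x] replaces [C] there; [D x] is what the telescoping sum
   leaves once its nonpositive end term is dropped. *)
exists (2 * B x - 2 * C + D x) => t.
have le_iter tau : expected_cost p mu x tau <=
    2 * iter tau P B x + iter tau P (D - P D) x.
  rewrite expected_costE.
  (* Gathering the bound under one iterate reduces it, by monotonicity, to the pointwise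
     inequality. *)
  have -> : 2 * iter tau P B x + iter tau P (D - P D) x =
            iter tau P (2 *: B + (D - P D)) x.
    have -> : iter tau P (2 *: B + (D - P D)) =
              2 *: iter tau P B + iter tau P (D - P D).
      by elim: tau => //= tau ->; rewrite /P linearP.
    by rewrite !ffunE.
  apply: iter_transition_le => // y; rewrite !ffunE addrA.
  have := cost_le_displacement m mu y.
  by rewrite [displacement _ _]ffunE [transition _ _ _ _]ffunE.
apply: le_trans (ler_sum _ (fun tau _ => le_iter tau)) _.
rewrite big_split /= -mulr_sumr.
have := congr1 (fun f : {ffun state S k n -> R^o} => f x)
  (sum_iter_coboundary P D t.+1).
rewrite sum_ffunE [RHS]ffunE => ->; rewrite [X in D x + X]ffunE.
have DN_ge0 : 0 <= iter t.+1 P D x.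
  rewrite -(iter_transition_cst p (next_state mu) p_sum1 t.+1 0 x).
  by apply: iter_transition_le => // y; rewrite ffunE displacement_ge0.
have -> : \sum_(0 <= tau < t.+1) iter tau P B x = B x + C * t%:R.
  rewrite big_nat_recl //=; congr (_ + _).
  under eq_bigr do rewrite -iterS iterSr PB iter_transition_cst //.
  by rewrite sumr_const_nat subn0 mulr_natr.
rewrite -natr1; lra.
Qed.

End KServer.

Theorem theorem5 (R : realType) (S : finMetricType R) (k n : nat)
    (hS : (0 < #|S|)%N) (hn : (1 <= n)%N) (hnk : (n <= k)%N)
    (p : requests S n -> R) (hp : is_pmf p)
    (mstar : servers S k) (hmstar : optimal_placement hnk p mstar)
    (mud : policy S k n) (hmud : decentralized_policy mstar mud)
    (mustar : policy S k n) (hmustar : optimal_policy p mustar)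
    (x0 : state S k n) :
  average_cost p mud x0 <= 2 * average_cost p mustar x0.
Proof.
set C := placement_cost hnk p mstar.
have upper : average_cost p mud x0 <= 2 * C.
  have [K sumK] := sum_expected_cost_le hnk p hp mstar mud x0 hmud.
  have cvgK : ((fun t : nat => 2 * C + t.+1%:R^-1 * K) @ \oo --> 2 * C)%classic.
    rewrite -[X in (_ --> X)%classic]addr0; apply: cvgD; first exact: cvg_cst.
    exact: (@cvg_bounded_div _ (fun=> K) `|K|).
  rewrite -(cvg_lim _ cvgK) //; apply: ler_lim.
  - exact: is_cvg_average_cost.
  - by apply/cvg_ex; exists (2 * C).
  - near=> t; apply: le_trans (ler_wpM2l _ (sumK t)) _; first by rewrite invr_ge0.
    by rewrite mulrDr mulrCA mulVf ?pnatr_eq0 // mulr1.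
have lower : C <= average_cost p mustar x0.
  (* The lower bound [C] holds only from time 1 on; the initial cost [e0] enters through a
     correction that vanishes in the average. *)
  pose e0 := expected_cost p mustar x0 0.
  have cvgK : ((fun t : nat => C + t.+1%:R^-1 * (e0 - C)) @ \oo --> C)%classic.
    rewrite -[X in (_ --> X)%classic]addr0; apply: cvgD; first exact: cvg_cst.
    exact: (@cvg_bounded_div _ (fun=> e0 - C) `|e0 - C|).
  rewrite -(cvg_lim _ cvgK) //; apply: ler_lim.
  - by apply/cvg_ex; exists C.
  - exact: is_cvg_average_cost.
  - near=> t; rewrite -(@ler_pM2l _ t.+1%:R) ?ltr0n // mulrDr
      !mulVKf ?pnatr_eq0 //.
    rewrite big_nat_recl //=.
    have : \sum_(0 <= i < t) C <=
           \sum_(0 <= i < t) expected_cost p mustar x0 i.+1.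
      by apply: ler_sum => i _; exact: expected_cost_ge.
    rewrite sumr_const_nat subn0 -mulr_natl -natr1 -/e0; lra.
lra.
Unshelve. all: by end_near. Qed.
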